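(* Let $\mathcal{P}=\bigcup_{i=1}^k\mathcal{P}_i$ be a path system on a multicommodity network $(G,c,H)$ with $H=\{[s_i,t_i]: i=1,\dots,k\}$, and let $\mathbf{b}=(b_1,\dots,b_k)$ with $b_i>0$. Then the Extended Maximum Concurrent Flow Problem with Saturated Capacity (EMCFPSC) for $\mathcal{P}$ and $\mathbf{b}$ has a solution.
   Context: A hybrid graph $G=(V,E)$ is a finite graph each of whose edges may be either directed or undirected. A multicommodity network is a triad $(G,c,H)$ with $G=(V,E)$ a hybrid graph, $c:E\to\mathbb{R}_+=[0,\infty)$ a capacity function, and $H=\{[s_i,t_i]: s_i,t_i\in V,\ i=1,\dots,k\}$, where $s_i$ and $t_i$ are the source and terminal of commodity $i$. An $s_i$-$t_i$-path is a sequence $P=[(s_i,e_0,v_1),(v_1,e_1,v_2),\dots,(v_l,e_l,t_i)]$ where the nodes $s_i=v_0,v_1,\dots,v_l,v_{l+1}=t_i$ are pairwise different, except that $s_i=t_i$ is allowed, and $e_j$ is an edge with endpoints $v_j$ and $v_{j+1}$ (if $e_j$ is directed, it is directed from $v_j$ to $v_{j+1}$). $E(P)$ denotes the set of edges of $P$. For each $i$ let $\mathcal{P}_i$ be a set of $s_i$-$t_i$-paths such that $c(e)>0$ for all $e\in E(P)$, $P\in\mathcal{P}_i$. Then $\mathcal{P}=\bigcup_{i=1}^k\mathcal{P}_i$ is called a path system on $(G,c,H)$, and $E(\mathcal{P})=\bigcup_{P\in\mathcal{P}}E(P)$. A flow on $\mathcal{P}$ is a mapping $y:\mathcal{P}\to\mathbb{R}_+$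 with $\sum_{P\in\mathcal{P},\,e\in E(P)}y(P)\le c(e)$ for all $e\in E(\mathcal{P})$. $F$ denotes the set of all flows on $\mathcal{P}$. Put $V(y)=\sum_{P\in\mathcal{P}}y(P)$ (flow value) and $V_i(y)=\sum_{P\in\mathcal{P}_i}y(P)$ (branch flow value of commodity $i$). EMCFP: find a flow $y'\in F$ with $V_i(y')\le b_i$ for all $i$ such that $$\min_{1\le i\le k}\tfrac{1}{b_i}V_i(y')=\max\Big\{\min_{1\le i\le k}\tfrac{1}{b_i}V_i(y): y\in F,\ V_i(y)\le b_i\ (i=1,\dots,k)\Big\}.$$ EMCFPSC: find a solution $y'$ of EMCFP such that $V(y')=\max\{V(y): y\text{ is a solution of EMCFP}\}$. *)

(* Defs.v *)
From mathcomp Require Import all_boot all_order all_algebra.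
From mathcomp Require Import all_classical all_reals.

Set Implicit Arguments.
Unset Strict Implicit.
Unset Printing Implicit Defensive.

Import Order.TTheory GRing.Theory Num.Theory.
Local Open Scope classical_set_scope.
Local Open Scope ring_scope.

(* Parallel edges and loops are allowed.  An undirected edge is stored with an
   arbitrary orientation, which [traverses] ignores. *)
Record hybrid_graph (V E : finType) := HybridGraph {
  end1 : E -> V;
  end2 : E -> V;
  directed : pred E }.

Definition traverses (V E : finType) (G : hybrid_graph V E)
    (u : V) (e : E) (v : V) : bool :=
  (end1 G e == u) && (end2 G e == v)
  || [&& ~~ directed G e, end1 G e == v & end2 G e == u].

(* There are k.+1 commodities, indexed by 'I_k.+1: the minimum over commodities
   below only makes sense for at least one commodity. *)
Record network (R : realType) (V E : finType) (k : nat) := Network {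
  graph : hybrid_graph V E;
  cap : E -> R;
  cap_ge0 : forall e, 0 <= cap e;
  source : 'I_k.+1 -> V;
  terminal : 'I_k.+1 -> V }.

(* The triple (u, e, v) is a step from u to v along e. *)
Definition walk (V E : finType) : choiceType := seq (V * E * V).

Definition tails (V E : finType) (p : walk V E) : seq V := [seq a.1.1 | a <- p].
Definition edges (V E : finType) (p : walk V E) : seq E := [seq a.1.2 | a <- p].
Definition heads (V E : finType) (p : walk V E) : seq V := [seq a.2 | a <- p].

(* For p = [(s,e_0,v_1),...,(v_l,e_l,t)], [heads p] is v_1,...,v_l,t, so the
   equation on [tails p] says that consecutive steps match and that p starts at
   s.  The two [uniq] conditions say that s, v_1,...,v_l, t are pairwise
   different, except that s = t is allowed. *)
Definition st_path (V E : finType) (G : hybrid_graph V E) (s t : V)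
    (p : walk V E) : Prop :=
  [/\ p != [::],
      tails p = belast s (heads p) /\ last s (heads p) = t,
      uniq (tails p),
      uniq (heads p) &
      all (fun a => traverses G a.1.1 a.1.2 a.2) p].

Definition path_system (R : realType) (V E : finType) (k : nat)
    (N : network R V E k) (Ps : 'I_k.+1 -> set (walk V E)) : Prop :=
  forall i p, Ps i p ->
    st_path (graph N) (source N i) (terminal N i) p /\
    (forall e, e \in edges p -> 0 < cap N e).

Definition all_paths (V E : finType) (k : nat)
    (Ps : 'I_k.+1 -> set (walk V E)) : set (walk V E) :=
  \bigcup_(i in [set: 'I_k.+1]) Ps i.

(* Sums over a set of walks are finitely supported sums; on the sets of paths
   considered here they are plain finite sums. *)
Lemma finite_all_paths (R : realType) (V E : finType) (k : nat)
    (N : network R V E k) (Ps : 'I_k.+1 -> set (walk V E)) :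
  path_system N Ps -> finite_set (all_paths Ps).
Proof.
move=> sysP.
apply: (@sub_finite_set _ _
  ((fun q : #|V|.-bseq (V * E * V) => (q : walk V E)) @` [set: _])).
  move=> p [i _ /sysP [[_ _ uniq_tails _ _] _]].
  have le_p : (size p <= #|V|)%N.
    by rewrite -(size_map (fun a => a.1.1)) -(card_uniqP uniq_tails) max_card.
  by exists (Bseq le_p).
exact/finite_image/finite_finset.
Qed.

Definition path_edges (V E : finType) (k : nat)
    (Ps : 'I_k.+1 -> set (walk V E)) : set E :=
  [set e | exists2 p, all_paths Ps p & e \in edges p].

(* A flow is a total function on walks of which only the values on
   [all_paths Ps] matter. *)
Definition is_flow (R : realType) (V E : finType) (k : nat)
    (N : network R V E k) (Ps : 'I_k.+1 -> set (walk V E))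
    (y : walk V E -> R) : Prop :=
  (forall p, all_paths Ps p -> 0 <= y p) /\
  (forall e, path_edges Ps e ->
     \sum_(p \in [set p | all_paths Ps p /\ e \in edges p]) y p <= cap N e).

Definition flow_value (R : realType) (V E : finType) (k : nat)
    (Ps : 'I_k.+1 -> set (walk V E)) (y : walk V E -> R) : R :=
  \sum_(p \in all_paths Ps) y p.

Definition branch_value (R : realType) (V E : finType) (k : nat)
    (Ps : 'I_k.+1 -> set (walk V E)) (i : 'I_k.+1) (y : walk V E -> R) : R :=
  \sum_(p \in Ps i) y p.

(* The default value of the iterated minimum is one of its terms. *)
Definition min_ratio (R : realType) (V E : finType) (k : nat)
    (Ps : 'I_k.+1 -> set (walk V E)) (b : 'I_k.+1 -> R)
    (y : walk V E -> R) : R :=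
  \big[Num.min/(b ord0)^-1 * branch_value Ps ord0 y]_(i < k.+1)
    ((b i)^-1 * branch_value Ps i y).

Definition is_max (R : realType) (A : set R) (m : R) : Prop :=
  A m /\ ubound A m.

Definition emcfp_feasible (R : realType) (V E : finType) (k : nat)
    (N : network R V E k) (Ps : 'I_k.+1 -> set (walk V E))
    (b : 'I_k.+1 -> R) : set (walk V E -> R) :=
  [set y | is_flow N Ps y /\ forall i, branch_value Ps i y <= b i].

Definition emcfp_solution (R : realType) (V E : finType) (k : nat)
    (N : network R V E k) (Ps : 'I_k.+1 -> set (walk V E))
    (b : 'I_k.+1 -> R) : set (walk V E -> R) :=
  [set y' | emcfp_feasible N Ps b y' /\
    is_max [set min_ratio Ps b y | y in emcfp_feasible N Ps b]
           (min_ratio Ps b y')].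

Definition emcfpsc_solution (R : realType) (V E : finType) (k : nat)
    (N : network R V E k) (Ps : 'I_k.+1 -> set (walk V E))
    (b : 'I_k.+1 -> R) : set (walk V E -> R) :=
  [set y' | emcfp_solution N Ps b y' /\
    is_max [set flow_value Ps y | y in emcfp_solution N Ps b]
           (flow_value Ps y')].

(* Main.v *)
Require Import Defs.
From mathcomp Require Import all_boot all_order all_algebra.
From mathcomp Require Import all_classical all_reals.
From mathcomp Require Import topology normedtype derive.

Set Implicit Arguments.
Unset Strict Implicit.
Unset Printing Implicit Defensive.

Import Order.TTheory GRing.Theory Num.Theory.
Import numFieldNormedType.Exports.
Local Open Scope classical_set_scope.
Local Open Scope ring_scope.

(** The theorem holds because EMCFPSC is a lexicographic maximization of two
    continuous functions on a compact set.  There are only finitely many paths,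
    so branch values, the flow value and the loads on the edges are finite sums
    of coordinates of the flow, hence continuous for the topology of pointwise
    convergence, and so is a minimum of finitely many scaled branch values.
    The constraints are non-strict inequalities between continuous functions,
    so the feasible set is closed ([emcfp_feasible_closed]).  The bounds
    V_i(y) <= b_i force 0 <= y(P) <= b_1 + ... + b_k on every path, and by
    Tychonoff the functions with all values in that interval form a compact
    set ([boxed_feasible_compact]).

    A flow is a function on all walks and its values off the path system are
    arbitrary, so the feasible set itself is not bounded.  This is harmless:
    every quantity of the problem depends only on the values on the paths, and
    replacing the other values by 0 ([restrict_boxed]) brings any feasible flow
    into the box without changing its objectives.  It therefore suffices to
    maximize the concurrent ratio over the feasible flows in the box, and then
    the flow value over the compact set of those maximizers
    ([compact_lexicographic_max]). *)

(** The maximizers of [f] on [K] are the points of [K] in a closed level set of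
    [f]; they form a compact set, on which [g] has a maximum in its turn. *)
Lemma compact_lexicographic_max (R : realType) (T : topologicalType)
    (K : set T) (f g : T -> R) :
  K !=set0 -> compact K -> continuous f -> continuous g ->
  exists2 c, K c & (forall t, K t -> f t <= f c) /\
                   (forall t, K t -> f t = f c -> g t <= g c).
Proof.
move=> K0 cK cf cg.
have [c0 /set_mem Kc0 f_le] :=
  compact_EVT_max K0 cK (continuous_subspaceT cf).
pose L := K `&` f @^-1` [set x | x = f c0].
have cL : compact L.
  apply: compact_closedI => //.
  by apply: preimage_closed; [move=> ? _; exact: cf | exact: closed_eq].
have L0 : L !=set0 by exists c0.
have [c /set_mem [Kc fc] g_le] :=
  compact_EVT_max L0 cL (continuous_subspaceT cg).
exists c => //; split=> t Kt; first by rewrite fc f_le ?inE.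
by move=> ft; apply: g_le; rewrite inE; split; rewrite //= ft.
Qed.

Lemma fsum_coord_continuous (R : realType) (I : choiceType) (A : set I) :
  finite_set A ->
  continuous (fun y : {ptws I -> R} => \sum_(p \in A) y p : R).
Proof.
move=> finA.
have -> : (fun y : {ptws I -> R} => \sum_(p \in A) y p : R) =
    (fun y => \sum_(p <- finmap.enum_fset (fset_set A)) y p).
  by apply/funext => y; rewrite fsbig_finite.
apply: continuous_big => [|p _]; first exact: add_continuous.
exact: (@proj_continuous I (fun=> R : topologicalType) p).
Qed.

(** [continuous_big] has a constant default value, whereas that of [min_ratio]
    is itself a function of the flow. *)
Lemma bigmin_continuous (R : realType) (T : topologicalType) (I : Type)
    (r : seq I) (f0 : T -> R) (f : I -> T -> R) :
  continuous f0 -> (forall i, continuous (f i)) ->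
  continuous (fun x => \big[Num.min/f0 x]_(i <- r) f i x).
Proof.
move=> cf0 cf; elim: r => [|i r IHr].
  by under eq_fun do rewrite big_nil.
under eq_fun do rewrite big_cons.
by move=> x; apply: continuous_min; [exact: cf | exact: IHr].
Qed.

Lemma le_fsum_term (R : realType) (I : choiceType) (A : set I) (y : I -> R)
    (p : I) :
  finite_set A -> (forall q, A q -> 0 <= y q) -> A p ->
  y p <= \sum_(q \in A) y q.
Proof.
move=> finA y_ge0 Ap; rewrite (fsbigD1 p) //= lerDl.
by apply: fsumr_ge0 => q [/y_ge0].
Qed.

Lemma finite_paths (R : realType) (V E : finType) (k : nat)
    (N : network R V E k) (Ps : 'I_k.+1 -> set (walk V E)) (i : 'I_k.+1) :
  path_system N Ps -> finite_set (Ps i).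
Proof.
move=> sysP; apply: sub_finite_set (finite_all_paths sysP).
by move=> p Pp; exists i.
Qed.

Lemma branch_value_continuous (R : realType) (V E : finType) (k : nat)
    (N : network R V E k) (Ps : 'I_k.+1 -> set (walk V E)) (i : 'I_k.+1) :
  path_system N Ps ->
  continuous (branch_value Ps i : {ptws walk V E -> R} -> R).
Proof. by move=> /(finite_paths i) /fsum_coord_continuous. Qed.

Lemma flow_value_continuous (R : realType) (V E : finType) (k : nat)
    (N : network R V E k) (Ps : 'I_k.+1 -> set (walk V E)) :
  path_system N Ps ->
  continuous (flow_value Ps : {ptws walk V E -> R} -> R).
Proof. by move=> /finite_all_paths /fsum_coord_continuous. Qed.

Lemma min_ratio_continuous (R : realType) (V E : finType) (k : nat)
    (N : network R V E k) (Ps : 'I_k.+1 -> set (walk V E)) (b : 'I_k.+1 -> R) :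
  path_system N Ps ->
  continuous (min_ratio Ps b : {ptws walk V E -> R} -> R).
Proof.
move=> sysP.
have ratio_continuous i : continuous
    (fun y : {ptws walk V E -> R} => (b i)^-1 * branch_value Ps i y : R).
  move=> y; apply: (@cvgMl_tmp _ _ (nbhs y)).
  exact: (branch_value_continuous (i := i) sysP).
exact: (@bigmin_continuous R {ptws walk V E -> R} 'I_k.+1
  (index_enum 'I_k.+1) _ _ (ratio_continuous ord0) ratio_continuous).
Qed.

Lemma emcfp_feasible_closed (R : realType) (V E : finType) (k : nat)
    (N : network R V E k) (Ps : 'I_k.+1 -> set (walk V E)) (b : 'I_k.+1 -> R) :
  path_system N Ps ->
  closed (emcfp_feasible N Ps b : set {ptws walk V E -> R}).
Proof.
move=> sysP.
have closed_sub (f : {ptws walk V E -> R} -> R) (D : set R) :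
    continuous f -> closed D -> closed (f @^-1` D).
  by move=> cf cD; apply: preimage_closed => // ? _; exact: cf.
rewrite (_ : emcfp_feasible N Ps b =
  (\bigcap_(p in all_paths Ps) [set y | 0 <= y p]) `&`
  (\bigcap_(e in path_edges Ps)
     [set y | \sum_(p \in [set p | all_paths Ps p /\ e \in edges p]) y p
                <= cap N e]) `&`
  (\bigcap_(i in setT) [set y | branch_value Ps i y <= b i])); last first.
  apply/seteqP; split=> y.
    by move=> [[y_ge0 y_cap] y_b]; split=> [|i _]; [split|exact: y_b].
  by move=> [[y_ge0 y_cap] y_b]; split=> [|i]; [split|exact: y_b].
apply: closedI; first apply: closedI; apply: closed_bigI.
- move=> p _; apply: (closed_sub (fun y => y p) [set x | 0 <= x]).
    exact: (@proj_continuous _ (fun=> R : topologicalType) p).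
  exact: closed_ge.
- move=> e _; apply: (closed_sub (fun y => \sum_(p \in _) y p)
    [set x | x <= cap N e]); last exact: closed_le.
  apply: fsum_coord_continuous.
  by apply: sub_finite_set (finite_all_paths sysP) => p [].
- move=> i _; apply: (closed_sub (branch_value Ps i) [set x | x <= b i]).
    exact: branch_value_continuous sysP.
  exact: closed_le.
Qed.

Definition boxed_feasible (R : realType) (V E : finType) (k : nat)
    (N : network R V E k) (Ps : 'I_k.+1 -> set (walk V E))
    (b : 'I_k.+1 -> R) : set (walk V E -> R) :=
  [set y | forall p, y p \in `[0, \sum_i b i]] `&` emcfp_feasible N Ps b.

Lemma boxed_feasible_compact (R : realType) (V E : finType) (k : nat)
    (N : network R V E k) (Ps : 'I_k.+1 -> set (walk V E)) (b : 'I_k.+1 -> R) :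
  path_system N Ps ->
  compact (boxed_feasible N Ps b : set {ptws walk V E -> R}).
Proof.
move=> sysP; apply: compact_closedI; last exact: emcfp_feasible_closed.
apply: (@tychonoff _ (fun=> R : topologicalType)
  (fun=> [set` `[0, \sum_i b i]])) => _.
exact: segment_compact.
Qed.

Lemma boxed_feasible_nonempty (R : realType) (V E : finType) (k : nat)
    (N : network R V E k) (Ps : 'I_k.+1 -> set (walk V E)) (b : 'I_k.+1 -> R) :
  (forall i, 0 <= b i) -> boxed_feasible N Ps b !=set0.
Proof.
move=> b_ge0; exists (fun=> 0); split=> /= [p|].
  by rewrite in_itv /= lexx sumr_ge0.
split; first split=> // e _; last move=> i.
  by rewrite fsbig1 ?cap_ge0.
by rewrite /branch_value fsbig1.
Qed.

Lemma emcfp_objectives_ext (R : realType) (V E : finType) (k : nat)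
    (Ps : 'I_k.+1 -> set (walk V E)) (b : 'I_k.+1 -> R) (y z : walk V E -> R) :
  {in all_paths Ps, y =1 z} ->
  [/\ forall i, branch_value Ps i y = branch_value Ps i z,
      flow_value Ps y = flow_value Ps z &
      min_ratio Ps b y = min_ratio Ps b z].
Proof.
move=> yz.
have branch_yz i : branch_value Ps i y = branch_value Ps i z.
  by apply: eq_fsbigr => p /set_mem Pp; apply: yz; rewrite inE; exists i.
split=> //; first exact: eq_fsbigr.
by rewrite /min_ratio branch_yz; apply: eq_bigr => i _; rewrite branch_yz.
Qed.

(** On a path of commodity [i] a feasible flow lies between 0 and V_i(y), and
    V_i(y) <= b_i; the restriction is 0 elsewhere. *)
Lemma restrict_boxed (R : realType) (V E : finType) (k : nat)
    (N : network R V E k) (Ps : 'I_k.+1 -> set (walk V E)) (b : 'I_k.+1 -> R)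
    (y : walk V E -> R) :
  path_system N Ps -> (forall i, 0 <= b i) ->
  emcfp_feasible N Ps b y -> boxed_feasible N Ps b (y \_ (all_paths Ps)).
Proof.
move=> sysP b_ge0 [[y_ge0 y_cap] y_b].
have yE : {in all_paths Ps, y \_ (all_paths Ps) =1 y}.
  by move=> p; rewrite patchE => ->.
have [branchE _ _] := emcfp_objectives_ext b yE.
split=> [p /=|]; last split; [|split=> [p Pp|e Ee]|by move=> i; rewrite branchE].
- rewrite patchE in_itv /=; case: ifPn => [/set_mem Pp|_]; last first.
    by rewrite lexx sumr_ge0.
  rewrite y_ge0 //=; have [i _ Pip] := Pp.
  apply: le_trans (le_trans (y_b i) _).
    apply: le_fsum_term => //; first exact: finite_paths sysP.
    by move=> q Pq; apply: y_ge0; exists i.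
  by rewrite (bigD1 i) //= lerDl sumr_ge0.
- by rewrite yE ?inE // y_ge0.
- rewrite (eq_fsbigr y) ?y_cap // => p /set_mem [Pp _].
  by rewrite yE ?inE.
Qed.

Theorem theorem1 (R : realType) (V E : finType) (k : nat)
    (N : network R V E k) (Ps : 'I_k.+1 -> set (walk V E)) (b : 'I_k.+1 -> R)
    (Ps_system : path_system N Ps) (b_gt0 : forall i, 0 < b i) :
  exists y' : walk V E -> R, emcfpsc_solution N Ps b y'.
Proof.
have b_ge0 i : 0 <= b i by exact: ltW.
have [c [_ feas_c] [ratio_le value_le]] := compact_lexicographic_max
  (T := {ptws walk V E -> R}) (boxed_feasible_nonempty N Ps b_ge0)
  (boxed_feasible_compact (b := b) Ps_system)
  (min_ratio_continuous (b := b) Ps_system) (flow_value_continuous Ps_system).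
(* Both maxima extend from the box to all feasible flows by restriction. *)
have restrictE (y : walk V E -> R) :
    {in all_paths Ps, y \_ (all_paths Ps) =1 y}.
  by move=> p; rewrite patchE => ->.
have ratio_max y :
    emcfp_feasible N Ps b y -> min_ratio Ps b y <= min_ratio Ps b c.
  move=> feas_y; have [_ _ <-] := emcfp_objectives_ext b (restrictE y).
  exact/ratio_le/restrict_boxed.
have sol_c : emcfp_solution N Ps b c.
  by split=> //; split; [exists c | move=> _ [y feas_y <-]; exact: ratio_max].
exists c; split=> //; split; first by exists c.
move=> _ [y [feas_y [_ y_max]] <-].
have [_ <- ratioE] := emcfp_objectives_ext b (restrictE y).
apply: value_le; first exact: restrict_boxed.
by rewrite ratioE; apply/eqP; rewrite eq_le ratio_max // y_max //; exists c.
Qed.
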